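(* For every constant $C_0>0$ there is a constant $C>0$ (depending only on $C_0$) such that the following holds. Let $F$ be a field of odd positive characteristic $p$, and let $A\subset F_*=F\setminus\{0\}$ be a finite set with $|A|>1$ and $|A|\le C_0\,p^{2/3}$. Then $$\mathrm{T}(A)\ \le\ C\,|A|^{9/2}.$$
   Context: $\mathrm{T}(A)$ denotes the number of collinear triples of points of $P=A\times A\subset F^2$, i.e. the number of ordered triples $((a,a'),(b,b'),(c,c'))\in P^3$ (points not necessarily distinct) lying on a common line of $F^2$, equivalently with $$\det\begin{pmatrix}1&1&1\\ a&b&c\\ a'&b'&c'\end{pmatrix}=0 .$$ *)

(* Defs.v *)
From HB Require Import structures.
From mathcomp Require Import all_boot all_order all_algebra.
From mathcomp Require Import finmap.
From mathcomp Require Import boolp reals exp.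
From mathcomp Require Import ring.

Set Implicit Arguments.
Unset Strict Implicit.
Unset Printing Implicit Defensive.

Import GRing.Theory.
Local Open Scope ring_scope.

Section Collinear.
Variable F : fieldType.
Implicit Types (x y z : F * F) (A : {fset F}).

(* Lines u X + v Y = w with (u, v) != (0, 0); unlike slope-intercept form this
   covers vertical lines. *)
Definition on_line (u v w : F) x : Prop := u * x.1 + v * x.2 = w.

Definition collinear x y z : Prop :=
  exists u v w : F,
    [/\ (u, v) != (0, 0), on_line u v w x, on_line u v w y & on_line u v w z].

Definition collinear_triples A : {fset (F * F) * (F * F) * (F * F)} :=
  let P := (A `*` A)%fset in
  [fset t in (P `*` P `*` P)%fset | `[< collinear t.1.1 t.1.2 t.2 >]]%fset.

Definition nb_collinear_triples A : nat := #|` collinear_triples A|.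

Definition collinear_mx x y z : 'M[F]_3 :=
  \matrix_(i < 3, j < 3)
    let q := nth x [:: x; y; z] j in nth 0 [:: 1; q.1; q.2] i.

Lemma det_collinear_mx x y z :
  \det (collinear_mx x y z) =
  (y.1 - x.1) * (z.2 - x.2) - (z.1 - x.1) * (y.2 - x.2).
Proof.
rewrite (expand_det_row _ ord0) !big_ord_recl big_ord0 /cofactor.
rewrite !(expand_det_row _ ord0) !big_ord_recl !big_ord0 /cofactor.
rewrite !det_mx11 !mxE /=; ring.
Qed.

Lemma collinear_det x y z :
  collinear x y z <-> \det (collinear_mx x y z) = 0.
Proof.
rewrite det_collinear_mx /collinear /on_line.
case: x y z => [a a'] [b b'] [c c'] /=; split.
  case=> u [v [w [nz0 Ex Ey Ez]]]; set d := (X in X = 0).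
  have ud : u * d = 0.
    have -> : u * d = (u * b + v * b' - (u * a + v * a')) * (c' - a')
       - (u * c + v * c' - (u * a + v * a')) * (b' - a') by rewrite /d; ring.
    by rewrite Ex Ey Ez !subrr !mul0r subrr.
  have vd : v * d = 0.
    have -> : v * d = (u * c + v * c' - (u * a + v * a')) * (b - a)
       - (u * b + v * b' - (u * a + v * a')) * (c - a) by rewrite /d; ring.
    by rewrite Ex Ey Ez !subrr !mul0r subrr.
  move: nz0; rewrite xpair_eqE negb_and => /orP[] /negPf nz.
    by move/eqP: ud; rewrite mulf_eq0 nz => /eqP.
  by move/eqP: vd; rewrite mulf_eq0 nz => /eqP.
have line_through s s' : (s, s') != (a, a') ->
  (s' - a', a - s) != (0, 0).
  by rewrite !xpair_eqE !subr_eq0 (eq_sym a s) andbC.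
move=> d0; have [[-> ->]|/line_through nz] := eqVneq (b, b') (a, a').
  have [[-> ->]|/line_through nz] := eqVneq (c, c') (a, a').
    by exists 1, 0, a; rewrite xpair_eqE oner_eq0; split=> //; ring.
  by exists (c' - a'), (a - c), ((c' - a') * a + (a - c) * a'); split=> //; ring.
exists (b' - a'), (a - b), ((b' - a') * a + (a - b) * a'); split=> //.
  by ring.
by apply/eqP; rewrite -subr_eq0 -oppr_eq0 -d0; apply/eqP; ring.
Qed.

End Collinear.

(* Main.v *)
(** Work over K = F(t). To (a, c, b') and to (a', c', b) in A^3 attach lines u
    |-> (u, y + x u, z + x^2 u) of K^3, of slopes x = a and x = a', in such a
    way that, for a <> a', the two lines meet iff (a, a'), (b, b'), (c, c')
    are collinear; a shear by t prevents lines of the same kind from meeting,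
    so at most two lines pass through a point. It suffices to show that every
    subfamily contains a line meeting O(|A|^(3/2)) others. If not, a nonzero
    polynomial f of degree D = O(|A|^(3/2)) < p vanishes on a whole subfamily
    in which every line meets more than C D others; take f of least degree. At
    a point of a line l where df <> 0 only two directions (1, x, x^2) are
    tangent to f = 0: that of l, and that of the second line through the
    point, whose slope xi(u) is therefore a rational function along l. The
    second order contact of f with the second line, which holds at more than 5
    D points of l, holds all along l; this being so for every line, third
    order contact yields (xi - x) xi'' = 2 xi'^2 at the meeting points, hence
    all along l. As degrees are less than p, the solutions are Moebius
    functions of u: either xi takes each of the |A| slopes at most once, or xi
    is constant and the lines meeting l are coplanar and parallel. In both
    cases l meets O(|A| + D) lines, a contradiction. *)

Require Import Defs.
From mathcomp Require Import all_boot all_order all_algebra.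
From mathcomp Require Import finmap.
From mathcomp Require Import boolp reals exp.
From mathcomp Require Import ring zify lra.
From mathcomp Require Import -(notations) mpoly.
Set Implicit Arguments.
Unset Strict Implicit.
Unset Printing Implicit Defensive.
Import Order.TTheory GRing.Theory Num.Theory.
Local Open Scope ring_scope.

(** * Graphs: deleting a vertex with control of averaged weights *)

Section Averaging.
Variables (I : finType) (e : rel I) (g : nat -> nat).
Hypothesis e_irr : irreflexive e.
Implicit Type S : {set I}.

Definition deg S i := #|[set j in S | e i j]|.

(* In a uniformly random ordering of S the number of neighbours preceding a vertex
   of degree k is uniform on {0, ..., k}: avg k is the expected value of g there,
   and exists_avg_del derandomizes the choice of the last vertex. *)
Definition avg k : rat := (\sum_(j < k.+1) g j)%:R / k.+1%:R.

Lemma avg_rec k : k%:R * avg k.-1 + (g k)%:R = k.+1%:R * avg k.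
Proof.
rewrite /avg [RHS]mulrC divfK ?pnatr_eq0 // [in RHS]big_ord_recr /= natrD; congr (_ + _).
case: k => [|k] /=; first by rewrite big_ord0 mul0r.
by rewrite mulrC divfK ?pnatr_eq0.
Qed.

Lemma degD1 S v u : v \in S -> deg (S :\ v) u = (deg S u - e u v)%N.
Proof.
move=> vS; rewrite /deg; case: (boolP (e u v)) => uv.
  rewrite (cardsD1 v [set j in S | e u j]) !inE vS uv addKn; apply: eq_card => j.
  by rewrite !inE andbA.
rewrite subn0; apply: eq_card => j; rewrite !inE.
by have [->|] := eqVneq j v; rewrite /= ?(negPf uv) ?andbF.
Qed.

(** Deleting one of the d neighbours of u lowers its degree to d - 1, and deleting any of the #|S| -
    d - 1 other vertices leaves it at d; [avg_rec] adds up the two contributions. *)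
Lemma sum_avg_del S u : u \in S ->
  (g (deg S u))%:R + \sum_(v in S | v != u) avg (deg (S :\ v) u) = #|S|%:R * avg (deg S u).
Proof.
move=> uS; set d := deg S u.
have dS : (d < #|S|)%N.
  rewrite (cardsD1 u) uS add1n ltnS; apply: subset_leq_card; apply/subsetP => j.
  by rewrite !inE => /andP[-> uj]; rewrite andbT; apply: contraTneq uj => ->; rewrite e_irr.
rewrite (bigID (e u)) /=.
rewrite (eq_bigr (fun=> avg d.-1)); last first.
  by move=> v /andP[/andP[vS _] uv]; rewrite degD1 // uv subn1.
rewrite [X in _ + (_ + X)](eq_bigr (fun=> avg d)); last first.
  by move=> v /andP[/andP[vS _] uv]; rewrite degD1 // (negPf uv) subn0.
rewrite !sumr_const.
have -> : #|(fun v => (v \in S) && (v != u) && e u v)| = d.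
  apply: eq_card => v; rewrite !inE unfold_in /=.
  by have [->|] := eqVneq v u; rewrite ?e_irr ?andbF ?andbT.
have -> : #|(fun v => (v \in S) && (v != u) && ~~ e u v)| = (#|S| - d.+1)%N.
  have <- : #|(S :\ u) :\: [set v | e u v]| = #|(fun v => (v \in S) && (v != u) && ~~ e u v)|.
    by apply: eq_card => v; rewrite !inE unfold_in /= andbC [(v != u) && _]andbC.
  rewrite cardsD; have := cardsD1 u S; rewrite uS add1n => ->.
  rewrite subSS; congr (_ - _)%N; apply: eq_card => v; rewrite !inE.
  by have [->|] := eqVneq v u; rewrite ?e_irr ?andbF.
rewrite -(mulr_natl _ d) -(mulr_natl _ (#|S| - d.+1)) addrA (addrC (g d)%:R) avg_rec -mulrDl -natrD.
by rewrite subnKC.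
Qed.

Lemma exists_avg_del S : S != set0 -> exists2 v, v \in S &
  (g (deg S v))%:R + \sum_(u in S :\ v) avg (deg (S :\ v) u) <= \sum_(u in S) avg (deg S u).
Proof.
move=> /set0Pn[x xS]; set M := \sum_(u in S) _.
pose F v := (g (deg S v))%:R + \sum_(u in S :\ v) avg (deg (S :\ v) u).
(* Summed over all v and regrouped by u, the left sides have mean exactly [M], so some v does not
   exceed it. *)
have EF : \sum_(v in S) F v = #|S|%:R * M.
  rewrite mulr_sumr; under [RHS]eq_bigr => u uS do rewrite -sum_avg_del //.
  rewrite !big_split /=; congr (_ + _).
  rewrite (exchange_big_dep (mem S)) //=; last by move=> v u _; rewrite !inE => /andP[].
  apply: eq_bigr => u uS; apply: eq_bigl => v; rewrite !inE uS andbT.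
  by rewrite eq_sym.
have [/existsP[v /andP[vS le]]|/existsPn H] := boolP [exists v, (v \in S) && (F v <= M)].
  by exists v.
have : \sum_(v in S) M < \sum_(v in S) F v.
  apply: ltr_sum => [|v vS]; first by apply/hasP; exists x; rewrite ?mem_index_enum.
  by have := H v; rewrite vS /= -ltNge.
by rewrite EF sumr_const mulr_natl ltxx.
Qed.
End Averaging.

(** * Graphs: counting edges by peeling off vertices of small degree *)

Section Peeling.
Variables (I : finType) (e : rel I) (q : nat).
Hypothesis e_sym : ssrbool.symmetric e.
Hypothesis poor : forall S : {set I}, S != set0 -> exists2 i, i \in S & (deg e S i <= q)%N.

(** Induction by removing a vertex of degree at most [q]: edges are ordered pairs, so at most
    [2 * q] of them disappear with it. *)
Lemma card_edges_le (S : {set I}) :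
  (#|[set x : I * I | [&& x.1 \in S, x.2 \in S & e x.1 x.2]]| <= 2 * q * #|S|)%N.
Proof.
have [n] := ubnP #|S|; elim: n S => // n IH S Sn.
have [->|S0] := eqVneq S set0.
  by rewrite cards0 muln0 leqn0 cards_eq0; apply/eqP/setP => x; rewrite !inE.
have [i iS iq] := poor S0; have Si := cardsD1 i S; rewrite iS in Si.
set T := [set x | _]; set T' := [set x : I * I | [&& x.1 \in S :\ i, x.2 \in S :\ i & e x.1 x.2]].
pose N := [set j in S | e i j].
have sub : T \subset T' :|: (setX [set i] N :|: setX N [set i]).
  apply/subsetP => -[x y]; rewrite !inE /= => /and3P[xS yS xy].
  have [Ex|xi] /= := eqVneq x i; first by rewrite yS -Ex xy.
  have [Ey|yi] /= := eqVneq y i; last by rewrite xS yS xy.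
  by rewrite xS e_sym -Ey xy orbT.
apply: leq_trans (subset_leq_card sub) _.
have T'le : (#|T'| <= 2 * q * #|S :\ i|)%N by apply: IH; move: Sn; rewrite Si.
apply: leq_trans (leq_card_setU _ _) _; rewrite Si add1n mulnS addnC leq_add //.
apply: leq_trans (leq_card_setU _ _) _; rewrite !cardsX cards1 mul1n muln1.
by rewrite mul2n -addnn leq_add.
Qed.
End Peeling.

(** * Univariate polynomials of degree below the characteristic: Wronskians and the Moebius
    equation *)

Section Univariate.
Variable K : fieldType.
Implicit Types (p q r : {poly K}).

Definition wronsk p q := p^`() * q - p * q^`().

Lemma coefM_top p q a b : (size p <= a.+1)%N -> (size q <= b.+1)%N ->
  (p * q)`_(a + b) = p`_a * q`_b.
Proof.
move=> pa qb; have a_lt : (a < (a + b).+1)%N by rewrite ltnS leq_addr.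
rewrite coefM (bigD1 (Ordinal a_lt)) //= addKn big1 ?addr0 // => i.
rewrite -val_eqE /= neq_ltn => /orP[lt_ia|lt_ai].
  by rewrite [q`__]nth_default ?mulr0 // (leq_trans qb) //; lia.
by rewrite [p`__]nth_default ?mul0r // (leq_trans pa).
Qed.

Lemma natr_inj_pchar ch i j : ch \in [pchar K] -> (i < ch)%N -> (j < ch)%N ->
  i%:R = j%:R :> K -> i = j.
Proof.
move=> pK; wlog le_ij : i j / (i <= j)%N => [IH|] ip jp E.
  by case/orP: (leq_total i j) => le; [exact: IH|apply/esym/IH].
have : (ch %| j - i)%N by rewrite (dvdn_pcharf pK) natrB // E subrr.
case: (posnP (j - i)) => [|d0 /(dvdn_leq d0)]; lia.
Qed.

(** Subtract from q the multiple of r that cancels the coefficient of index deg r. If the difference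
    d is nonzero, the coefficient of index deg d + deg r in ['X * wronsk d r] is (deg d - deg r)
    times both leading coefficients. Hence deg d = deg r modulo [ch], so exactly, although d has no
    coefficient there. *)
Lemma wronsk_eq0 ch q r : ch \in [pchar K] -> (size q <= ch)%N -> (size r <= ch)%N ->
  r != 0 -> wronsk q r = 0 -> exists k, q = k *: r.
Proof.
move=> pK sq sr r0 W0; pose j := (size r).-1; exists (q`_j / lead_coef r).
set k := q`_j / _; apply/eqP; rewrite -subr_eq0; set d := q - _.
have Wd : wronsk d r = 0.
  rewrite -W0 /wronsk /d derivB derivZ -!mul_polyC; ring.
have dj : d`_j = 0.
  by rewrite coefB coefZ /k divfK ?subrr // lead_coef_eq0.
apply: contraT => d0; pose i := (size d).-1.
have sd : (size d <= ch)%N.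
  by rewrite (leq_trans (size_polyD _ _)) // geq_max sq size_polyN (leq_trans (size_scale_leq _ _)).
have si : size d = i.+1 by rewrite prednK // size_poly_gt0.
have sj : size r = j.+1 by rewrite prednK // size_poly_gt0.
have di : d`_i != 0 by rewrite -[d`_i]/(lead_coef d) lead_coef_eq0.
have rj : r`_j != 0 by rewrite -[r`_j]/(lead_coef r) lead_coef_eq0.
have eulerE (s : {poly K}) n : size s = n.+1 ->
    (size ('X * s^`())%R <= n.+1)%N /\ ('X * s^`())`_n = s`_n *+ n.
  move=> ss; split; last by rewrite coefXM; case: n {ss} => [|n] //=; rewrite coef_deriv.
  apply: leq_trans (size_polyMleq _ _) _; rewrite size_polyX addSn add1n /=.
  by have := lt_size_deriv (p := s); rewrite -size_poly_gt0 ss => /(_ isT).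
have [sXd cXd] := eulerE _ _ si; have [sXr cXr] := eulerE _ _ sj.
have : ('X * wronsk d r)`_(i + j) = 0 by rewrite Wd mulr0 coef0.
rewrite /wronsk mulrBr mulrA mulrCA coefB !coefM_top ?si ?sj // cXd cXr.
rewrite -(mulr_natr _ i) -(mulr_natr _ j) mulrAC mulrA -mulrBr => /eqP.
rewrite !mulf_eq0 (negPf di) (negPf rj) /= subr_eq0 => /eqP ij.
have eij : i = j by apply: natr_inj_pchar pK _ _ ij; rewrite -?si -?sj.
by rewrite eij dj eqxx in di.
Qed.

Lemma size_polyM_add p q a b : (size p <= a)%N -> (size q <= b)%N -> (size (p * q)%R <= a + b)%N.
Proof.
move=> pa qb; apply: leq_trans (size_polyMleq _ _) _.
by rewrite (leq_trans (leq_pred _)) // leq_add.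
Qed.

Lemma size_deriv_leq p : (size p^`() <= size p)%N.
Proof. by have [->|/lt_size_deriv/ltnW//] := eqVneq p 0; rewrite deriv0. Qed.

Lemma size_wronsk p q a b : (size p <= a)%N -> (size q <= b)%N -> (size (wronsk p q) <= a + b)%N.
Proof.
move=> pa qb; apply: leq_trans (size_polyD _ _) _; rewrite geq_max size_polyN.
by rewrite !size_polyM_add // (leq_trans (size_deriv_leq _)).
Qed.

(* For xi = x + r / p the hypothesis reads (xi - x) xi'' = 2 xi'^2, that is
   (wronsk r p / r ^+ 2)' = 0. *)
Lemma moebius_of_ode ch p r D : ch \in [pchar K] -> (D.*2 < ch)%N ->
  (size p <= D)%N -> (size r <= D)%N -> r != 0 ->
  r * (wronsk r p)^`() - 2 * wronsk r p * r^`() = 0 ->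
  exists c k, p = (c%:P - k *: 'X) * r.
Proof.
move=> chK D_lt sp sr r0 E; set W := wronsk r p in E.
have sr2 : (size (r ^+ 2) <= ch)%N.
  by apply: leq_trans (size_polyM_add sr sr) _; lia.
have sW : (size W <= ch)%N by apply: leq_trans (size_wronsk sr sp) _; lia.
(* The hypothesis times r says that [W] and [r ^+ 2] have zero Wronskian, so W = k r^2. *)
have [|k Wk] := wronsk_eq0 chK sW sr2 (expf_neq0 2 r0).
  rewrite /wronsk deriv_exp /= -[RHS](mulr0 r) -E; ring.
(* As (p / r)' = - W / r^2 = - k, the quotient p / r + k X has derivative zero. *)
have [|||c Ec] := @wronsk_eq0 ch (p + k%:P * 'X * r) r chK _ _ r0.
- apply: leq_trans (size_polyD _ _) _; rewrite geq_max (leq_trans sp) /=; last by lia.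
  apply: leq_trans (size_polyM_add (leqnn _) sr) _.
  rewrite mul_polyC (leq_trans (leq_add (size_scale_leq _ _) (leqnn _))) // size_polyX.
  have : (0 < size r)%N by rewrite size_poly_gt0.
  by lia.
- by apply: leq_trans sr _; lia.
- rewrite /wronsk derivD !derivM derivC derivX mul0r add0r mulr1.
  rewrite -[RHS](subrr W) {1}Wk /W /wronsk -mul_polyC; ring.
by exists c, k; rewrite mulrBl mul_polyC -Ec -mul_polyC addrK.
Qed.

Lemma exists_common_root n (P : seq 'cV[K]_n) : (size P < n)%N ->
  exists2 c : 'rV[K]_n, c != 0 & forall phi, phi \in P -> c *m phi = 0.
Proof.
move=> lt; pose M := \matrix_(i < n, j < size P) (nth 0 P j) i 0.
have : kermx M != 0.
  rewrite -mxrank_eq0 mxrank_ker subn_eq0 -ltnNge.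
  by rewrite (leq_ltn_trans (rank_leq_col M)).
case/rowV0Pn=> c /sub_kermxP cM c0; exists c => // phi /(nthP 0)[k kP <-].
apply/matrixP => i j; rewrite !ord1 mxE.
have := congr1 (fun N : 'rV_(size P) => N 0 (Ordinal kP)) cM.
by rewrite !mxE; under eq_bigr => x _ do rewrite mxE; rewrite /=.
Qed.

End Univariate.

(** * Trivariate polynomials restricted to lines of direction (1, x, x^2) *)

Section NullLines.
Variable K : fieldType.
Local Notation line := (K * K * K)%type.
Local Notation poly3 := (mpoly 3 K).
Local Notation deg3 f := (mmeasure mdeg f).
Local Notation i1 := (@Ordinal 3 1 isT).
Local Notation i2 := (@Ordinal 3 2 isT).
Local Notation dx f := (mderiv (@ord0 2) f).
Local Notation dy f := (mderiv i1 f).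
Local Notation dz f := (mderiv i2 f).
Implicit Types (l m : line) (f g : poly3) (u : K).

(* ((x, y), z) encodes the line u |-> (u, y + x u, z + x^2 u). *)
Definition line_pt l u : 'I_3 -> K :=
  fun i => nth 0 [:: u; l.1.2 + l.1.1 * u; l.2 + l.1.1 ^+ 2 * u] i.

Definition line_coord l : 'I_3 -> {poly K} :=
  fun i => nth 0 [:: 'X; (l.1.2)%:P + l.1.1%:P * 'X; (l.2)%:P + (l.1.1 ^+ 2)%:P * 'X] i.

Local Notation restr l := (mmap polyC (line_coord l)).

Lemma restrZ l c f : restr l (c *: f) = c%:P * restr l f.
Proof. exact: mmapZ. Qed.

(** The chain rule along l, checked on monomials. *)
Lemma deriv_restr l f : (restr l f)^`() =
  restr l (dx f) + l.1.1%:P * restr l (dy f) + (l.1.1 ^+ 2)%:P * restr l (dz f).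
Proof.
elim/mpolyind: f => [|c mm f _ _ IH].
  by rewrite !mderiv0 !rmorph0 deriv0 !mulr0 !addr0.
rewrite !mderivD !mderivZ !rmorphD /= !restrZ derivD IH.
rewrite derivM derivC mul0r add0r !mderivX !restrZ.
rewrite !mmapX /mmap1 !big_ord_recl !big_ord0 /=.
rewrite !(mnmBE, mnm1E) /= /line_coord /= !subn0 !subn1.
rewrite !(lift0, mulr1).
set a := fun_of_multinom _ _; set b := fun_of_multinom _ _.
set d := fun_of_multinom _ _.
have [-> ->] : i1 = lift ord0 (ord0 : 'I_2) /\ i2 = lift ord0 (lift ord0 (ord0 : 'I_1)).
  by split; apply: val_inj.
rewrite -/a -/b -/d.
rewrite !derivM !deriv_exp !derivD !derivM !derivC !derivX !mul0r !add0r !mulr1.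
rewrite -(mulr_natr (_ * _) b) -(mulr_natr (_ * _) d) -(mulr_natr (_ * _) a) -!polyC_natr.
move: (_ ^+ a) (_ ^+ b) (_ ^+ d) (_ ^+ a.-1) (_ ^+ b.-1) (_ ^+ d.-1) => A B D A' B' D'.
move: (polyC (a%:R : K)) (polyC (b%:R : K)) (polyC (d%:R : K)).
move: (polyC l.1.1) (polyC (l.1.1 ^+ 2)) (polyC c).
by move=> *; ring.
Qed.

Lemma horner_restr l f u : (restr l f).[u] = meval (line_pt l u) f.
Proof.
elim/mpolyind: f => [|c mm f _ _ IH].
  by rewrite rmorph0 horner0 meval0.
rewrite rmorphD /= restrZ hornerD hornerM hornerC IH mevalD mevalZ.
congr (_ * _ + _); rewrite mmapX mevalX /mmap1.
rewrite !big_ord_recl !big_ord0 /line_coord /line_pt /=.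
by rewrite !hornerE.
Qed.

(** [deg3] is the total degree plus one, just as [size] is in one variable, and the coordinates are
    affine in the parameter. *)
Lemma size_restr l f : (size (restr l f) <= deg3 f)%N.
Proof.
rewrite /mmap big_seq; elim/big_ind: _ => [|p q Hp Hq|mm Hm].
- by rewrite size_poly0.
- by apply: leq_trans (size_polyD _ _) _; rewrite geq_max Hp.
apply: leq_trans (msize_mdeg_lt Hm).
rewrite mul_polyC; apply: leq_trans (size_scale_leq _ _) _.
rewrite /mmap1 mdegE; elim/big_rec2: _ => [|i k P _ IH]; first by rewrite size_poly1.
apply: leq_trans (size_polyMleq _ _) _.
have Hc : (size (line_coord l i) <= 2)%N.
  have lin (a b : K) : (size (a%:P + b%:P * 'X)%R <= 2)%N.
    by rewrite addrC size_MXaddC; case: ifP => // _; rewrite ltnS size_polyC leq_b1.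
  case: i => [[|[|[|//]]] Hi]; rewrite /line_coord /= ?lin //.
  by rewrite size_polyX.
have := size_poly_exp_leq (line_coord l i) (fun_of_multinom mm i).
have : ((size (line_coord l i)).-1 * fun_of_multinom mm i <= fun_of_multinom mm i)%N.
  by rewrite -{2}[fun_of_multinom mm i]mul1n leq_mul2r; apply/orP; right; lia.
rewrite -ltnS => H1 /leq_trans/(_ H1) H2.
by have := leq_add H2 IH; rewrite addSn addnS; case: (_ + _)%N.
Qed.

Lemma deg3_mderiv i f : f != 0 -> (deg3 (mderiv i f) < deg3 f)%N.
Proof.
move=> f0; have : (0 < deg3 f)%N by rewrite lt0n mmeasure_poly_eq0.
rewrite [deg3 (mderiv i f)]msizeE => d0.
rewrite -(prednK d0) ltnS; apply/bigmax_leqP_seq => mm Hm _.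
have: mnm_add mm (mnm1 i) \in msupp f.
  move: Hm; rewrite !mcoeff_msupp mcoeff_mderiv; apply: contraNneq => ->.
  by rewrite mul0rn.
by move/msize_mdeg_lt; rewrite mdegD mdeg1 addn1; lia.
Qed.

(** All exponents are less than p, so a nonzero exponent remains nonzero in K and differentiation
    cannot kill its monomial. *)
Lemma mderiv_eq0_const p f : p \in [pchar K] -> (deg3 f <= p)%N ->
  (forall i, mderiv i f = 0) -> exists c, f = mpolyC 3 c.
Proof.
move=> pK dp df; exists (mcoeff (mnm0 (n := 3)) f).
apply: msize1_polyC; rewrite msizeE; apply/bigmax_leqP_seq => mm Hm _.
rewrite ltnS leqn0 mdeg_eq0; apply/eqP/mnmP => i; rewrite mnm0E.
case: (eqVneq (fun_of_multinom mm i) 0%N) => // mi.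
have Em : mm = mnm_add (mnm_sub mm (mnm1 i)) (mnm1 i).
  by rewrite submK //; apply/mnm_lepP => j; rewrite mnm1E; case: eqP => // <-; rewrite lt0n.
have := congr1 (mcoeff (mnm_sub mm (mnm1 i))) (df i).
rewrite mcoeff_mderiv -Em mcoeff0 mnmBE mnm1E eqxx subn1 prednK ?lt0n // => /eqP.
rewrite -mulr_natr mulf_eq0 (negPf (_ : mcoeff mm f != 0)) -?mcoeff_msupp //=.
rewrite -(dvdn_pcharf pK) => /dvdn_leq; rewrite lt0n mi => /(_ isT) pm.
have := leq_trans (msize_mdeg_lt Hm) dp.
rewrite mdegE (bigD1 i) //=; lia.
Qed.

Local Opaque mderiv meval mmap.

(** * Contact of the surface f = 0 with a second line through a point of l *)

Definition dir_deriv (x : K) f : poly3 := dx f + x *: dy f + x ^+ 2 *: dz f.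

Lemma deriv_restr_dir l f : (restr l f)^`() = restr l (dir_deriv l.1.1 f).
Proof. by rewrite deriv_restr !mmapD !mmapZ. Qed.

(* If f vanishes on l, a second direction (1, xi, xi^2) tangent to f = 0 at a
   point of l satisfies xi = l.1.1 + slope_num l f / slope_den l f. *)
Definition slope_den l f := restr l (dz f).
Definition slope_num l f := - restr l (dy f + (2 * l.1.1) *: dz f).
Definition ode l f := let r := slope_num l f in let W := wronsk r (slope_den l f) in
  r * W^`() - 2 * W * r^`().

(* slope_den ^+ 4 times the second derivative of f in the second direction. *)
Definition contact2 l f :=
  let p := slope_den l f in let q := slope_num l f + l.1.1%:P * p in
  restr l (dx (dx f)) * p ^+ 4 + restr l (2 *: dx (dy f)) * q * p ^+ 3 +
  restr l (dy (dy f) + 2 *: dx (dz f)) * q ^+ 2 * p ^+ 2 +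
  restr l (2 *: dy (dz f)) * q ^+ 3 * p + restr l (dz (dz f)) * q ^+ 4.

Lemma horner_ode l f u : let r := slope_num l f in let p := slope_den l f in
  (ode l f).[u] = r.[u] * (r^`()^`().[u] * p.[u] - r.[u] * p^`()^`().[u])
    - 2 * (r^`().[u] * p.[u] - r.[u] * p^`().[u]) * r^`().[u].
Proof.
move=> r p; rewrite /ode /wronsk -/r -/p.
rewrite !(derivB, derivM) !hornerE /=; ring.
Qed.

Lemma horner_deriv_quartic (a b c d e p q : {poly K}) u :
  (a * p ^+ 4 + b * q * p ^+ 3 + c * q ^+ 2 * p ^+ 2 + d * q ^+ 3 * p + e * q ^+ 4)^`().[u] =
  a^`().[u] * p.[u] ^+ 4 + b^`().[u] * q.[u] * p.[u] ^+ 3 + c^`().[u] * q.[u] ^+ 2 * p.[u] ^+ 2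
    + d^`().[u] * q.[u] ^+ 3 * p.[u] + e^`().[u] * q.[u] ^+ 4
  + q^`().[u] * (b.[u] * p.[u] ^+ 3 + 2 * c.[u] * q.[u] * p.[u] ^+ 2
       + 3 * d.[u] * q.[u] ^+ 2 * p.[u]
       + 4 * e.[u] * q.[u] ^+ 3)
  + p^`().[u] * (4 * a.[u] * p.[u] ^+ 3 + 3 * b.[u] * q.[u] * p.[u] ^+ 2
       + 2 * c.[u] * q.[u] ^+ 2 * p.[u]
       + d.[u] * q.[u] ^+ 3).
Proof.
rewrite !(derivD, derivM, deriv_exp) !(hornerD, hornerM, horner_exp, hornerMn); ring.
Qed.

Section Meet.
Variables (l m : line) (u : K) (f : poly3).
Hypothesis lm : line_pt l u =1 line_pt m u.
Hypothesis xneq : m.1.1 - l.1.1 != 0.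
Hypotheses (fl : restr l f = 0) (fm : restr m f = 0).
Local Notation e g := (meval (line_pt l u) g).

Lemma horner_restr_meet g : (restr m g).[u] = e g.
Proof. by rewrite !horner_restr; apply: meval_eq => i; rewrite lm. Qed.

Let commE := (fun h : poly3 => mderiv_comm i1 (@ord0 2) h,
  fun h : poly3 => mderiv_comm i2 (@ord0 2) h, fun h : poly3 => mderiv_comm i2 i1 h).
Let expE := (mderivD, mderivZ, mderivN, mevalD, mevalZ, mevalN).

(** The quadratic dx f + T dy f + T^2 dz f has both slopes as roots at the meeting point; this and
    [dx_meet] are Vieta's formulas. *)
Lemma dy_meet : e (dy f) = - (l.1.1 + m.1.1) * e (dz f).
Proof.
have := congr1 (fun P => P^`().[u]) fl; have := congr1 (fun P => P^`().[u]) fm.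
rewrite !deriv_restr_dir horner_restr_meet horner_restr /dir_deriv !expE deriv0 horner0.
move=> E1 E2.
apply: (mulfI xneq); apply: subr0_eq.
by rewrite -[RHS](subrr 0) -[X in _ = X - _]E1 -[X in _ = _ - X]E2; ring.
Qed.

Lemma dx_meet : e (dx f) = l.1.1 * m.1.1 * e (dz f).
Proof.
have := congr1 (fun P => P^`().[u]) fl.
rewrite !deriv_restr_dir horner_restr /dir_deriv !expE dy_meet deriv0 horner0.
move=> E2.
by apply: subr0_eq; rewrite -[RHS]E2; ring.
Qed.

(** This is the second derivative of f along m, which is zero because f vanishes on m; [ddd_meet] is
    the third. *)
Lemma dd_meet : e (dx (dx f)) + 2 * m.1.1 * e (dx (dy f))
  + m.1.1 ^+ 2 * (e (dy (dy f)) + 2 * e (dx (dz f)))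
  + 2 * m.1.1 ^+ 3 * e (dy (dz f)) + m.1.1 ^+ 4 * e (dz (dz f)) = 0.
Proof.
have := congr1 (fun P => P^`()^`().[u]) fm.
rewrite !deriv_restr_dir horner_restr_meet /dir_deriv !expE !commE !deriv0 horner0 => <-.
do ![move: (meval _ _) => ?].
ring.
Qed.


Lemma ddd_meet : let Y := m.1.1 in
  e (dx (dx (dx f))) + 3 * Y * e (dx (dx (dy f)))
  + Y ^+ 2 * (3 * e (dx (dy (dy f))) + 3 * e (dx (dx (dz f))))
  + Y ^+ 3 * (e (dy (dy (dy f))) + 6 * e (dx (dy (dz f))))
  + Y ^+ 4 * (3 * e (dx (dz (dz f))) + 3 * e (dy (dy (dz f))))
  + 3 * Y ^+ 5 * e (dy (dz (dz f))) + Y ^+ 6 * e (dz (dz (dz f))) = 0.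
Proof.
move=> Y; rewrite /Y.
have := congr1 (fun P => P^`()^`()^`().[u]) fm.
rewrite !deriv_restr_dir horner_restr_meet /dir_deriv !expE !commE !deriv0 horner0 => <-.
do ![move: (meval _ _) => ?].
ring.
Qed.

End Meet.

(** By [dy_meet] the q of [contact2] is the slope of m times p at u, which turns [contact2] into p^4
    times the left side of [dd_meet]. *)
Lemma contact2_meet l m u f : line_pt l u =1 line_pt m u -> m.1.1 - l.1.1 != 0 ->
  restr l f = 0 -> restr m f = 0 -> (contact2 l f).[u] = 0.
Proof.
move=> lm xneq fl fm.
have := dd_meet lm fm; rewrite /contact2 /slope_num /slope_den.
rewrite !(hornerD, hornerM, hornerN, hornerC, horner_exp, horner_restr) !(mevalD, mevalZ).
rewrite (dy_meet lm xneq fl fm); move: (meval _ (dz f)) => p.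
by do ![move: (meval _ _) => ?] => E0; rewrite -[RHS](mulr0 (p ^+ 4)) -E0; ring.
Qed.

Section OdeMeet.
Variables (l m : line) (u : K) (f : poly3).
Local Notation e g := (meval (line_pt l u) g).
Local Notation X := l.1.1.
Local Notation Y := m.1.1.

Lemma meval_dir x g : e (dir_deriv x g) = e (dx g) + x * e (dy g) + x ^+ 2 * e (dz g).
Proof. by rewrite !(mevalD, mevalZ). Qed.

Lemma mderiv_dir i x g : mderiv i (dir_deriv x g) = dir_deriv x (mderiv i g).
Proof.
rewrite /dir_deriv !(mderivD, mderivZ).
by rewrite (mderiv_comm ord0 i) (mderiv_comm i1 i) (mderiv_comm i2 i).
Qed.

Lemma dir_derivZ x c g : dir_deriv x (c *: g) = c *: dir_deriv x g.
Proof. by rewrite /dir_deriv !mderivZ !scalerDr !scalerA ![c * _]mulrC. Qed.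

Lemma dir_derivDZ x c g h : dir_deriv x (g + c *: h) = dir_deriv x g + c *: dir_deriv x h.
Proof.
rewrite -dir_derivZ; move: (c *: h) => k; rewrite /dir_deriv !mderivD !scalerDr.
by rewrite [RHS]addrACA; congr (_ + _); rewrite [RHS]addrACA.
Qed.

Lemma deriv_slope_num l' f' : (slope_num l' f')^`() =
  - restr l' (dir_deriv l'.1.1 (dy f') + (2 * l'.1.1) *: dir_deriv l'.1.1 (dz f')).
Proof. by rewrite derivN deriv_restr_dir dir_derivDZ. Qed.

Lemma meval_dir2 x g : e (dir_deriv x (dir_deriv x g)) =
  e (dx (dx g)) + x * e (dy (dx g)) + x ^+ 2 * e (dz (dx g))
 + x * (e (dx (dy g)) + x * e (dy (dy g)) + x ^+ 2 * e (dz (dy g)))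
 + x ^+ 2 * (e (dx (dz g)) + x * e (dy (dz g)) + x ^+ 2 * e (dz (dz g))).
Proof. by rewrite meval_dir !mderiv_dir !meval_dir. Qed.

Hypothesis lm : line_pt l u =1 line_pt m u.
Hypothesis xneq : Y - X != 0.
Hypotheses (fl : restr l f = 0) (fm : restr m f = 0).
Hypothesis contact2_m : contact2 m f = 0.
Hypothesis p0 : (slope_den l f).[u] != 0.

(** Let D_l and D_m differentiate in the directions of l and m, of slopes X and Y. Differentiating
    [contact2 m f] along m produces D_l D_l D_m f. Since D_m - D_l = (Y - X) (dy + (X + Y) dz),
    subtracting D_l D_l D_l f = 0 leaves D_l D_l (dy f + (X + Y) dz f), which up to the factor - p
    is the second order part r'' p - r p'' of [ode]. *)
Lemma ode_meet : (ode l f).[u] = 0.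
Proof.
have Em g : (restr m g).[u] = e g by exact: horner_restr_meet.
have Exx := dd_meet (fun=> erefl) fl (u := u).
have Eyy := dd_meet lm fm.
have Exxx := ddd_meet (fun=> erefl) fl (u := u).
have := congr1 (fun P => P^`().[u]) contact2_m.
rewrite horner_deriv_quartic horner_ode.
set p := e (dz f).
have -> : (slope_den m f).[u] = p by rewrite Em.
have Ep : (slope_den l f).[u] = p by rewrite horner_restr.
have -> : (slope_num m f + Y%:P * slope_den m f).[u] = X * p.
  rewrite hornerD hornerN hornerM hornerC !Em !(mevalD, mevalZ) (dy_meet lm xneq fl fm) -/p; ring.
have -> : (slope_num l f).[u] = (Y - X) * p.
  rewrite hornerN horner_restr !(mevalD, mevalZ) (dy_meet lm xneq fl fm) -/p; ring.
have dirm g : (restr m g)^`().[u] = e (dx g) + Y * e (dy g) + Y ^+ 2 * e (dz g).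
  by rewrite deriv_restr_dir Em meval_dir.
have dirmZ c g : (restr m (c *: g))^`().[u] = c * (e (dx g) + Y * e (dy g) + Y ^+ 2 * e (dz g)).
  by rewrite dirm !mderivZ !mevalZ; ring.
have dirmDZ c g h : (restr m (g + c *: h))^`().[u] = e (dx g) + Y * e (dy g) + Y ^+ 2 * e (dz g)
    + c * (e (dx h) + Y * e (dy h) + Y ^+ 2 * e (dz h)).
  by rewrite mmapD derivD hornerD dirmZ dirm.
have eZ c g : (restr m (c *: g)).[u] = c * e g by rewrite Em mevalZ.
have eDZ c g h : (restr m (g + c *: h)).[u] = e g + c * e h by rewrite Em mevalD mevalZ.
have -> : (slope_num m f + Y%:P * slope_den m f)^`().[u] =
    - (e (dx (dy f)) + Y * e (dy (dy f)) + Y ^+ 2 * e (dz (dy f)))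
    - Y * (e (dx (dz f)) + Y * e (dy (dz f)) + Y ^+ 2 * e (dz (dz f))).
  rewrite derivD derivN derivM derivC mul0r add0r hornerD hornerN hornerM hornerC dirmDZ dirm; ring.
rewrite deriv0 horner0 dirm dirmZ dirmDZ (dirmZ 2 (dy (dz f))) !dirm eZ eDZ eZ !Em.
have dirl g : (restr l g)^`().[u] = e (dx g) + X * e (dy g) + X ^+ 2 * e (dz g).
  by rewrite deriv_restr_dir horner_restr meval_dir.
have -> : (slope_num l f)^`().[u] =
    - (e (dx (dy f)) + X * e (dy (dy f)) + X ^+ 2 * e (dz (dy f)))
    - 2 * X * (e (dx (dz f)) + X * e (dy (dz f)) + X ^+ 2 * e (dz (dz f))).
  by rewrite deriv_slope_num hornerN horner_restr mevalD mevalZ opprD !meval_dir.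
pose e2 g := e (dx (dx g)) + X * e (dy (dx g)) + X ^+ 2 * e (dz (dx g))
 + X * (e (dx (dy g)) + X * e (dy (dy g)) + X ^+ 2 * e (dz (dy g)))
 + X ^+ 2 * (e (dx (dz g)) + X * e (dy (dz g)) + X ^+ 2 * e (dz (dz g))).
have -> : (slope_num l f)^`()^`().[u] = - e2 (dy f) - 2 * X * e2 (dz f).
  rewrite deriv_slope_num derivN deriv_restr_dir dir_derivDZ hornerN horner_restr.
  by rewrite mevalD mevalZ opprD !meval_dir2.
have -> : (slope_den l f)^`()^`().[u] = e2 (dz f).
  by rewrite !deriv_restr_dir horner_restr meval_dir2.
rewrite (dirl (dz f)) /e2.
move: p0 Exx Eyy Exxx; rewrite Ep /=.
rewrite -/p.
rewrite ?[dx (dy _)]mderiv_comm ?[dx (dz _)]mderiv_comm ?[dy (dz _)]mderiv_comm.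
rewrite ?[dx (dy _)]mderiv_comm ?[dx (dz _)]mderiv_comm ?[dy (dz _)]mderiv_comm.
clear Ep; move: p => p p0'.
move: (e (dx (dx f))) (e (dy (dx f))) (e (dz (dx f))).
move: (e (dy (dy f))) (e (dz (dy f))) (e (dz (dz f))).
move=> yy yz zz xx xy xz.

move: (e (dx (dx (dx f)))) (e (dy (dx (dx f)))) (e (dz (dx (dx f)))) (e (dy (dy (dx f)))).
move: (e (dz (dy (dx f)))) (e (dz (dz (dx f)))) (e (dy (dy (dy f)))) (e (dz (dy (dy f)))).
move: (e (dz (dz (dy f)))) (e (dz (dz (dz f)))).
move=> zzz yzz yyz yyy xzz xyz xyy xxz xxy xxx Exx Eyy Exxx E.
(* E says that the relation contact2 m f = 0 persists to first order along m. *)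
pose v := xy + X * yy + X ^+ 2 * yz + 2 * X * (xz + X * yz + X ^+ 2 * zz).
apply: (mulfI (mulf_neq0 xneq (expf_neq0 2 p0'))); rewrite mulr0.
(* The zeros are placeholders, replaced in turn by the left sides of [E], [Exxx], [Exx], [Eyy] and
   [Exx]: the goal is this linear combination of them. *)
rewrite -[RHS](_ : - (Y - X) * 0 + p ^+ 3 * ((Y - X) * p * 0 + 2 * v * 0 - 2 * v * 0
  + 4 * (Y - X) * (xz + Y * yz + Y ^+ 2 * zz) * 0) = 0); last by ring.
rewrite -{1}E -{1}Exxx -{1}Exx -{1}Eyy -Exx /v; ring.
Qed.
End OdeMeet.

(** * Incidence of two lines, and degree bounds for the contact polynomials *)

Definition meets l m : bool :=
  (l.1.1 != m.1.1) && (l.2 - m.2 == (l.1.1 + m.1.1) * (l.1.2 - m.1.2)).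

Definition meet_at l m : K := - (l.1.2 - m.1.2) / (l.1.1 - m.1.1).

Lemma meetsC l m : meets l m = meets m l.
Proof.
rewrite /meets eq_sym -(eqr_opp (l.2 - m.2)) opprB addrC -mulrN opprB [m.1.1 + _]addrC //.
Qed.

(** The second coordinates agree only at u = [meet_at l m]; substituting this into the third ones
    gives the equation of [meets]. *)
Lemma meetsP l m u : l.1.1 != m.1.1 ->
  (meets l m /\ u = meet_at l m) <-> (line_pt l u =1 line_pt m u).
Proof.
move=> lm; have lm0 : l.1.1 - m.1.1 != 0 by rewrite subr_eq0.
rewrite /meets lm /=; split=> [[/eqP E ->]|E].
  have Eb : l.1.2 + l.1.1 * meet_at l m = m.1.2 + m.1.1 * meet_at l m.
    by rewrite /meet_at; field.
  have Ec : l.2 + l.1.1 ^+ 2 * meet_at l m = m.2 + m.1.1 ^+ 2 * meet_at l m.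
    apply: subr0_eq; rewrite opprD addrACA E /meet_at; by field.
  by case=> [[|[|[|//]]] Hi]; rewrite /line_pt /=.
have := E i1; have := E i2; rewrite /line_pt /= => Ec Eb.
have Eu : u * (l.1.1 - m.1.1) = - (l.1.2 - m.1.2).
  apply: subr0_eq; rewrite -[RHS](subrr (m.1.2 + m.1.1 * u)) -{1}Eb; ring.
split; last by rewrite /meet_at -Eu mulfK.
apply/eqP; apply: subr0_eq.
rewrite -[RHS](subrr (m.2 + m.1.1 ^+ 2 * u)) -{1}Ec.
have -> : (l.1.1 + m.1.1) * (l.1.2 - m.1.2) = - (l.1.1 + m.1.1) * (u * (l.1.1 - m.1.1)).
  by rewrite Eu mulrN mulNr opprK.
by ring.
Qed.

Lemma line_pt_inj l m u : line_pt l u =1 line_pt m u -> l.1.1 = m.1.1 -> l = m.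
Proof.
move=> E Ex; have := E i1; have := E i2; rewrite /line_pt /= Ex => /addIr Ec /addIr Eb.
by case: l m Ex Ec Eb {E} => [[? ?] ?] [[? ?] ?] /= -> -> ->.
Qed.

Lemma slope_num_meet l m f : meets l m -> restr l f = 0 -> restr m f = 0 ->
  (slope_num l f).[meet_at l m] = (m.1.1 - l.1.1) * (slope_den l f).[meet_at l m].
Proof.
move=> lm fl fm; have x0 := lm; move: x0; rewrite /meets => /andP[x0 _].
have E := (meetsP (meet_at l m) x0).1 (conj lm erefl).
rewrite /slope_num /slope_den hornerN !horner_restr mevalD mevalZ (dy_meet E _ fl fm); last first.
  by rewrite subr_eq0 eq_sym.
ring.
Qed.

Lemma deg3_mderiv_leq i f D : (deg3 f <= D.+1)%N -> (deg3 (mderiv i f) <= D)%N.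
Proof.
have [->|f0 df] := eqVneq f 0; first by rewrite mderiv0 mmeasure0.
by rewrite -ltnS (leq_trans (deg3_mderiv i f0)).
Qed.

Lemma size_slope_den l f D : (deg3 f <= D.+1)%N -> (size (slope_den l f) <= D)%N.
Proof. by move/(deg3_mderiv_leq i2); apply: leq_trans; apply: size_restr. Qed.

Lemma size_slope_num l f D : (deg3 f <= D.+1)%N -> (size (slope_num l f) <= D)%N.
Proof.
move=> df; rewrite size_polyN (leq_trans (size_restr _ _)) // (leq_trans (msizeD_le _ _)) //.
by rewrite geq_max (leq_trans (msizeZ_le _ _)) !deg3_mderiv_leq.
Qed.

(** Every term is a product of five polynomials of size at most [D]; in [ode] there are three. *)
Lemma size_contact2 l f D : (deg3 f <= D.+1)%N -> (size (contact2 l f) <= 5 * D)%N.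
Proof.
move=> df; have d2 i j : (deg3 (mderiv i (mderiv j f)) <= D)%N.
  by apply: deg3_mderiv_leq; apply: leqW; apply: deg3_mderiv_leq.
have restr2 g : (deg3 g <= D)%N -> (size (restr l g) <= D)%N by apply/leq_trans/size_restr.
have sp := size_slope_den l df.
have sq : (size (slope_num l f + l.1.1%:P * slope_den l f)%R <= D)%N.
  rewrite (leq_trans (size_polyD _ _)) // geq_max size_slope_num //= mul_polyC.
  by rewrite (leq_trans (size_scale_leq _ _)).
rewrite /contact2; set p := slope_den l f in sp sq *; set q := slope_num l f + _ * p in sq *.
have pw (r : {poly K}) n : (size r <= D)%N -> (size (r ^+ n.+1)%R <= n.+1 * D)%N.
  move=> sr; elim: n => [|n IH]; first by rewrite expr1 mul1n.
  by rewrite exprS [(n.+2 * D)%N]mulSn size_polyM_add.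
have sc c g : (deg3 g <= D)%N -> (deg3 (c *: g) <= D)%N by apply: leq_trans; apply: msizeZ_le.
rewrite -[(5 * D)%N]/((D + (D + (D + (D + (D + 0)))))%N) addn0.
do ?[rewrite (leq_trans (size_polyD _ _)) // geq_max; apply/andP; split].
- rewrite size_polyM_add ?restr2 //; by have := pw p 3%N sp; rewrite !mulSn mul0n addn0.
- rewrite -mulrA size_polyM_add ?restr2 ?sc // size_polyM_add //.
  by have := pw p 2%N sp; rewrite !mulSn mul0n addn0.
- rewrite -mulrA size_polyM_add ?restr2 //.
    by rewrite (leq_trans (msizeD_le _ _)) // geq_max d2 sc.
  rewrite addnA size_polyM_add //.
    by have := pw q 1%N sq; rewrite !mulSn mul0n addn0.
  by have := pw p 1%N sp; rewrite !mulSn mul0n addn0.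
- rewrite -mulrA size_polyM_add ?restr2 ?sc // mulrC size_polyM_add //.
  by have := pw q 2%N sq; rewrite !mulSn mul0n addn0.
- rewrite size_polyM_add ?restr2 //; by have := pw q 3%N sq; rewrite !mulSn mul0n addn0.
Qed.

Lemma size_ode l f D : (deg3 f <= D.+1)%N -> (size (ode l f) <= 3 * D)%N.
Proof.
move=> df; have sp := size_slope_den l df; have sr := size_slope_num l df.
have sW := size_wronsk sr sp.
rewrite /ode (leq_trans (size_polyD _ _)) // geq_max size_polyN.
have -> : (3 * D = D + (D + D))%N by lia.
rewrite size_polyM_add ?(leq_trans (size_deriv_leq _)) //= addnC.
rewrite size_polyM_add ?(leq_trans (size_deriv_leq _)) //.
by rewrite -(polyC_natr _ 2) mul_polyC (leq_trans (size_scale_leq _ _)).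
Qed.

(** * Families in which every line meets many others: no low degree polynomial vanishes on them *)

Section Star.
Variables (I : finType) (L : I -> line) (S : {set I}).
Hypothesis L_inj : injective L.
Definition nbr i := [set j in S | meets (L i) (L j)].
Hypothesis triangle_free : forall i j k, i \in S -> j \in S -> k \in S ->
  meets (L i) (L j) -> meets (L i) (L k) -> meets (L j) (L k) -> False.

(** Two lines through the same point of [L i] either have equal slopes, hence coincide, or form a
    triangle with it. *)
Lemma meet_at_inj i : i \in S -> {in nbr i &, injective (fun j => meet_at (L i) (L j))}.
Proof.
move=> iS j k; rewrite !inE => /andP[jS ij] /andP[kS ik] /= E.
have /andP[x1 _] := ij; have /andP[x2 _] := ik.
have E1 := (meetsP _ x1).1 (conj ij erefl).
have E2 := (meetsP _ x2).1 (conj ik erefl); rewrite -E in E2.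
apply: L_inj.
have E3 : line_pt (L j) (meet_at (L i) (L j)) =1 line_pt (L k) (meet_at (L i) (L j)).
  by move=> t; rewrite -E1 -E2.
have [x|x] := eqVneq (L j).1.1 (L k).1.1; first exact: line_pt_inj E3 x.
by case: (triangle_free iS jS kS ij ik ((meetsP _ x).2 E3).1).
Qed.

Lemma card_roots (N : {set I}) (w : I -> K) (P : {poly K}) :
  {in N &, injective w} -> (forall j, j \in N -> P.[w j] = 0) -> P != 0 ->
  (#|N| < size P)%N.
Proof.
move=> w_inj wN P0; rewrite cardE -(size_map w).
apply: max_poly_roots => //.
  by apply/allP => _ /mapP[j jN ->]; rewrite rootE wN // -mem_enum.
by rewrite map_inj_in_uniq ?enum_uniq // => j k; rewrite !mem_enum; apply: w_inj.
Qed.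

Variables (ch D v : nat).
Hypothesis chK : ch \in [pchar K].
Hypothesis D_lt : (D.*2.+1 < ch)%N.
Hypothesis S0 : S != set0.
Hypothesis slopes : forall N : {set I}, {in N &, injective (fun j => (L j).1.1)} -> (#|N| <= v)%N.
Hypothesis heights : forall N : {set I}, {in N &, injective (fun j => (L j).1.2)} -> (#|N| <= v)%N.
Hypothesis rich : forall i, i \in S -> (5 * D + v < #|nbr i|)%N.

Lemma slope_den_eq0 f i : f != 0 -> (deg3 f <= D.+1)%N ->
  (forall j, j \in S -> restr (L j) f = 0) -> i \in S -> slope_den (L i) f = 0.
Proof.
move=> f0 df fS iS; apply/eqP; apply: contraT => p0.
have meet j : j \in nbr i -> [/\ j \in S, meets (L i) (L j) &
    line_pt (L i) (meet_at (L i) (L j)) =1 line_pt (L j) (meet_at (L i) (L j))].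
  by rewrite inE => /andP[jS ij]; split=> //; apply/meetsP => //; case/andP: ij.
have c0 j : j \in S -> contact2 (L j) f = 0.
  move=> jS; apply/eqP; apply: contraT => R0.
  have : (#|nbr j| < size (contact2 (L j) f))%N.
    apply: card_roots (meet_at_inj jS) _ R0 => k.
    rewrite inE => /andP[kS jk]; have /andP[x0 _] := jk.
    apply: contact2_meet (fS _ jS) (fS _ kS); last by rewrite subr_eq0 eq_sym.
    by apply/meetsP.
  by have := size_contact2 (L j) df; have := rich jS; lia.
pose u j := meet_at (L i) (L j); set p := slope_den (L i) f in p0; set r := slope_num (L i) f.
(* Fewer than D meetings are lost to the roots of [p], which leaves more than 4 D + v, enough to
   force [ode] to vanish identically. *)
pose N := [set j in nbr i | p.[u j] != 0].
have N_nbr j : j \in N -> j \in nbr i by rewrite inE => /andP[].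
have N_p j : j \in N -> p.[u j] != 0 by rewrite inE => /andP[].
have N_x j : j \in N -> (L j).1.1 - (L i).1.1 != 0.
  by move=> /N_nbr/meet[_ /andP[x0 _] _]; rewrite subr_eq0 eq_sym.
have u_inj : {in N &, injective u}.
  by move=> j k /N_nbr jN /N_nbr kN; apply: meet_at_inj.
have N_big : (4 * D + v < #|N|)%N.
  have : (#|nbr i :\: N| < size p)%N.
    apply: (card_roots (w := u)) => // [j k|j]; rewrite !inE.
      by move=> /andP[_ jn] /andP[_ kn]; apply: meet_at_inj => //; rewrite inE.
    by move=> /andP[H1 H2]; move: H1; rewrite H2 /= negbK => /eqP.
  have : N \subset nbr i by apply/subsetP.
  move/setIidPr => EN; have := cardsID N (nbr i); rewrite EN.
  by have := rich iS; have := size_slope_den (L i) df; rewrite -/p; lia.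
have ode0 : ode (L i) f = 0.
  apply/eqP; apply: contraT => R0.
  have : (#|N| < size (ode (L i) f))%N.
    apply: card_roots u_inj _ R0 => j jN; have [jS ij E] := meet j (N_nbr j jN).
    by apply: (ode_meet (m := L j)); rewrite ?fS ?c0 ?N_x ?N_p.
  by have := size_ode (L i) df; lia.
have r_meet j : j \in N -> r.[u j] = ((L j).1.1 - (L i).1.1) * p.[u j].
  by move=> /N_nbr/meet[jS ij _]; apply: slope_num_meet => //; apply: fS.
have r0 : r != 0.
  have /card_gt0P[j jN] : (0 < #|N|)%N by lia.
  apply/eqP => r0; have := r_meet j jN; rewrite r0 horner0 => /esym/eqP.
  by rewrite mulf_eq0 (negPf (N_x j jN)) (negPf (N_p j jN)).
have [|c [k Ep]] := moebius_of_ode chK _ (size_slope_den (L i) df)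
  (size_slope_num (L i) df) r0 ode0.
  by lia.
(* The Moebius relation between the parameter of a meeting and the slope of the line met there. *)
have key j : j \in N -> (c - k * u j) * ((L j).1.1 - (L i).1.1) = 1.
  move=> jN; apply: (mulIf (N_p j jN)); rewrite -mulrA -r_meet // mul1r /p Ep.
  by rewrite hornerM !(hornerD, hornerN, hornerZ, hornerC, hornerX).
suff : (#|N| <= v)%N by lia.
(* For k = 0 all lines of [N] have one slope, and the equation of [meets] recovers each from its
   height. For k <> 0 the slope determines the meeting parameter, hence the line. *)
have [k0|k0] := eqVneq k 0.
  have xE j : j \in N -> (L j).1.1 = (L i).1.1 + c^-1.
    move=> /key; rewrite k0 mul0r subr0 => E.
    have c_neq0 : c != 0.
      by apply: contra_eq_neq E => ->; rewrite mul0r eq_sym oner_neq0.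
    by apply: (addIr (- (L i).1.1)); apply: (mulfI c_neq0); rewrite E addrAC subrr add0r divff.
  apply: heights => j j' jN jN' /= Eb; apply: L_inj.
  have [_ /andP[_ /eqP Ec] _] := meet j (N_nbr j jN).
  have [_ /andP[_ /eqP Ec'] _] := meet j' (N_nbr j' jN').
  have Ex : (L j).1.1 = (L j').1.1 by rewrite (xE _ jN) (xE _ jN').
  have : (L j).2 = (L j').2.
    by apply: oppr_inj; apply: (addrI (L i).2); rewrite Ec Ec' Ex Eb.
  by case: (L j) (L j') Ex Eb => [[? ?] ?] [[? ?] ?] /= -> -> ->.
apply: slopes => j j' jN jN' /= Ex; apply: u_inj => //.
apply: (mulfI k0); apply: (addrI (- c)); apply: oppr_inj; rewrite !opprD !opprK.
by apply: (mulIf (N_x j jN)); rewrite key // Ex key.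
Qed.

(** By induction on the degree a partial derivative that vanishes on all the lines is zero. This
    applies to dz f by [slope_den_eq0]; then dy f and dx f vanish at all meeting points, hence on
    the rich lines. So f is a constant vanishing on a line. *)
Lemma no_vanishing_poly f : (deg3 f <= D.+1)%N -> (forall j, j \in S -> restr (L j) f = 0) -> f = 0.
Proof.
have [n] := ubnP (deg3 f); elim: n f => // n IH f fn df fS.
apply/eqP; apply: contraT => f0.
have IHd i : (forall j, j \in S -> restr (L j) (mderiv i f) = 0) -> mderiv i f = 0.
  have := deg3_mderiv i f0; move=> lt vS; apply: IH => //; last by rewrite ltnW // (leq_trans lt).
  by rewrite (leq_trans lt) // -ltnS.
have fz : dz f = 0 by apply: IHd => j; apply: slope_den_eq0.
have roots i : (forall j k, j \in S -> k \in nbr j ->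
    meval (line_pt (L j) (meet_at (L j) (L k))) (mderiv i f) = 0) -> mderiv i f = 0.
  move=> H; apply: IHd => j jS; apply/eqP; apply: contraT => R0.
  have : (#|nbr j| < size (restr (L j) (mderiv i f)))%N.
    by apply: card_roots (meet_at_inj jS) _ R0 => k kj; rewrite horner_restr H.
  have := size_restr (L j) (mderiv i f); have := deg3_mderiv_leq i df; have := rich jS; lia.
have fy : dy f = 0.
  apply: roots => j k jS; rewrite inE => /andP[kS jk]; have /andP[x0 _] := jk.
  have E := (meetsP _ x0).1 (conj jk erefl).
  by rewrite (dy_meet E _ (fS _ jS) (fS _ kS)) ?fz ?meval0 ?mulr0 // subr_eq0 eq_sym.
have fx : dx f = 0.
  apply: roots => j k jS; rewrite inE => /andP[kS jk]; have /andP[x0 _] := jk.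
  have E := (meetsP _ x0).1 (conj jk erefl).
  by rewrite (dx_meet E _ (fS _ jS) (fS _ kS)) ?fz ?meval0 ?mulr0 // subr_eq0 eq_sym.
have [||c Ef] := @mderiv_eq0_const ch f chK.
- by rewrite (leq_trans df) //; move: D_lt; lia.
- move=> i; have [Ei|Ei|Ei] : [\/ i = ord0, i = i1 | i = i2].
    case: i => [[|[|[|//]]] Hi]; [apply: Or31|apply: Or32|apply: Or33]; exact: val_inj.
  + by rewrite Ei. + by rewrite Ei. + by rewrite Ei.
have /set0Pn[j jS] := S0.
have := fS j jS; rewrite Ef mmapC => /eqP; rewrite polyC_eq0 => /eqP c0.
by move: f0; rewrite Ef c0 mpolyC0 eqxx.
Qed.

End Star.

(** * Parameter counting: a nonzero polynomial vanishing on a given family *)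

Section Vanishing.
Variable E : nat.
Local Notation box := ('I_E.+1 * 'I_E.+1 * 'I_E.+1)%type.
Local Notation dim := #|{: box}|.
Local Notation D := (3 * E)%N.

(** A cube of exponents makes the dimension exactly (E + 1)^3, with total degree at most 3 E. *)
Definition box_mnm (t : box) : multinom 3 :=
  Multinom [tuple nth 0%N [:: t.1.1 : nat; t.1.2 : nat; t.2 : nat] i | i < 3].

Definition box_poly (c : 'rV[K]_dim) : poly3 :=
  \sum_t c 0 (enum_rank t) *: mpolyX K (box_mnm t).

Lemma box_mnm_inj : injective box_mnm.
Proof.
move=> [[a b] c] [[a' b'] c'] /mnmP Em.
have := Em (@Ordinal 3 2 isT); have := Em (@Ordinal 3 1 isT); have := Em (@Ordinal 3 0 isT).
by rewrite !mnmE /= => /val_inj-> /val_inj-> /val_inj->.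
Qed.

Lemma deg3_box_poly c : (deg3 (box_poly c) <= D.+1)%N.
Proof.
rewrite /box_poly; elim/big_ind: _ => [|f g Hf Hg|t _]; first by rewrite mmeasure0.
  by rewrite (leq_trans (msizeD_le _ _)) // geq_max Hf.
rewrite (leq_trans (msizeZ_le _ _)) // msizeX ltnS mdegE !big_ord_recr big_ord0 /= !mnmE /=.
by case: t => [[a b] c'] /=; have := ltn_ord a; have := ltn_ord b; have := ltn_ord c'; lia.
Qed.

Lemma box_poly_eq0 c : box_poly c = 0 -> c = 0.
Proof.
move=> c0; apply/rowP => j; rewrite mxE -(enum_valK j).
have := congr1 (mcoeff (box_mnm (enum_val j))) c0.
rewrite mcoeff0 raddf_sum (bigD1 (enum_val j)) //= mcoeffZ mcoeffX eqxx mulr1.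
rewrite big1 ?addr0 // => t tj; rewrite mcoeffZ mcoeffX.
by rewrite (inj_eq box_mnm_inj) (negPf tj) mulr0.
Qed.

Definition coef_functional l k : 'cV[K]_dim :=
  \col_j (restr l (mpolyX K (box_mnm (enum_val j))))`_k.

Lemma coef_functionalE l k c : c *m coef_functional l k = ((restr l (box_poly c))`_k)%:M.
Proof.
apply/matrixP => i j; rewrite !ord1 !mxE eqxx mulr1n /box_poly rmorph_sum /= coef_sum.
rewrite (reindex (@enum_rank box)) /=; last exact: onW_bij (enum_rank_bij _).
by apply: eq_bigr => t _; rewrite mxE enum_rankK mmapZ coefCM.
Qed.

Section Lines.
Variables (I : finType) (L : I -> line).
Hypothesis L_inj : injective L.
Hypothesis triangle_free : forall i j k,
  meets (L i) (L j) -> meets (L i) (L k) -> meets (L j) (L k) -> False.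
Local Notation e := (fun i j => meets (L i) (L j)).
Local Notation g := (fun k => D.+1 - k)%N.

(* A line meeting k lines on which f already vanishes imposes only D + 1 - k
   further conditions on f. *)
Lemma exists_functionals (S : {set I}) : exists2 P : seq 'cV[K]_dim,
  (size P)%:R <= \sum_(i in S) avg g (deg e S i) &
  forall c, (forall phi, phi \in P -> c *m phi = 0) ->
    forall i, i \in S -> restr (L i) (box_poly c) = 0.
Proof.
have [n] := ubnP #|S|; elim: n S => // n IH S Sn.
have [->|S0] := eqVneq S set0.
  by exists [::] => [|c _ i]; rewrite ?big_set0 ?inE.
have [|v vS le] := @exists_avg_del _ e g _ S S0.
  by move=> i; rewrite /meets eqxx.
have [|P sP HP] := IH (S :\ v).
  by move: Sn; rewrite (cardsD1 v S) vS.
exists (P ++ [seq coef_functional (L v) k | k <- iota (deg e S v) (D.+1 - deg e S v)]).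
  by rewrite size_cat size_map size_iota natrD addrC (le_trans _ le) // lerD2l.
move=> c Hc; have HS : forall i, i \in S :\ v -> restr (L i) (box_poly c) = 0.
  by apply: HP => phi phiP; apply: Hc; rewrite mem_cat phiP.
move=> i iS; have [->|iv] := eqVneq i v; last by apply: HS; rewrite !inE iv.
apply/eqP; apply: contraT => R0.
have tri i' j k : i' \in S -> j \in S -> k \in S ->
  e i' j -> e i' k -> e j k -> False by move=> _ _ _; apply: triangle_free.
(* Each neighbour of v gives a root of the restriction to [L v]. A nonzero restriction thus has its
   leading coefficient among those of index at least [deg e S v], which the new functionals
   annihilate. *)
have lt : (deg e S v < size (restr (L v) (box_poly c)))%N.
  apply: (card_roots (meet_at_inj L_inj tri vS)) _ R0 => j; rewrite !inE => /andP[jS vj].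
  have /andP[x0 _] := vj; rewrite horner_restr.
  rewrite (meval_eq _ ((meetsP _ x0).1 (conj vj erefl))) -horner_restr HS ?horner0 //.
  by rewrite !inE jS andbT; apply: contraTneq vj => ->; rewrite /meets eqxx.
have cf k : (deg e S v <= k)%N -> (restr (L v) (box_poly c))`_k = 0.
  move=> dk; have [kD|Dk] := ltnP k D.+1; last first.
    by rewrite nth_default // (leq_trans (size_restr _ _)) // (leq_trans (deg3_box_poly _)).
  have /Hc : coef_functional (L v) k \in
      P ++ [seq coef_functional (L v) k | k <- iota (deg e S v) (D.+1 - deg e S v)].
    rewrite mem_cat map_f ?orbT // mem_iota dk /= subnKC //.
    by rewrite (leq_trans dk) // ltnW.
  rewrite coef_functionalE => /(congr1 (fun N : 'M_1 => N 0 0)).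
  by rewrite !mxE eqxx mulr1n.
have : lead_coef (restr (L v) (box_poly c)) = 0.
  by rewrite lead_coefE cf // -ltnS prednK // (leq_ltn_trans _ lt).
by move/eqP; rewrite lead_coef_eq0 (negPf R0).
Qed.

(** By truncated subtraction the weights add up to at most 1 + ... + (D + 1), however large k is. *)
Lemma avg_weight_le k q : (q <= k)%N -> avg g k <= (D.+2 * D.+1)%:R / (2 * q.+1)%:R.
Proof.
have sum_le (m d : nat) : (2 * \sum_(j < m) (d - j) <= d.+1 * d)%N.
  elim: m d => [|m IH] d; first by rewrite big_ord0.
  case: d => [|d]; first by rewrite big1.
  rewrite big_ord_recl subn0; under eq_bigr => j _ do rewrite lift0 subSS.
  by move: (\sum_(j < m) _)%N (IH d) => s; nia.
move=> qk; have q0 : 0 < q.+1%:R :> rat by rewrite ltr0n.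
have k0 : 0 < k.+1%:R :> rat by rewrite ltr0n.
rewrite /avg ler_pdivrMr // mulrAC ler_pdivlMr ?ltr0n // -!natrM ler_nat.
by apply: leq_trans (leq_mul (sum_le k.+1 D.+1) (qk : (q.+1 <= k.+1)%N)); rewrite mulnCA mulnA.
Qed.

Variables (ch v : nat) (S : {set I}) (q : nat).
Hypothesis chK : ch \in [pchar K].
Hypothesis D_lt : (D.*2.+1 < ch)%N.
Hypothesis S0 : S != set0.
Hypothesis slopes : forall N : {set I}, {in N &, injective (fun j => (L j).1.1)} -> (#|N| <= v)%N.
Hypothesis heights : forall N : {set I}, {in N &, injective (fun j => (L j).1.2)} -> (#|N| <= v)%N.
Hypothesis q_big : (5 * D + v < q)%N.
Hypothesis S_card : (#|S| * 9 <= 2 * E.+1 * q)%N.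

(** If every degree exceeded q, at most #|S| (D + 2) (D + 1) / (2 (q + 1)) conditions would suffice
    for vanishing on [S]. This is less than (E + 1)^3, so a nonzero polynomial would contradict
    [no_vanishing_poly]. *)
Lemma exists_poor_line : exists2 i, i \in S & (deg e S i <= q)%N.
Proof.
apply/exists_inP; apply: contraT; rewrite negb_exists_in => /forall_inP rich.
have [P sP HP] := exists_functionals S.
have lt : (size P < dim)%N.
  rewrite [X in (_ < X)%N](_ : _ = (E.+1 * E.+1 * E.+1)%N); last by rewrite !card_prod !card_ord.
  move: (size P) sP => sz sP.
  have : sz%:R <= #|S|%:R * ((D.+2 * D.+1)%:R / (2 * q.+1)%:R) :> rat.
    rewrite (le_trans sP) // mulr_natl -sumr_const; apply: ler_sum => i iS; apply: avg_weight_le.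
    by rewrite ltnW // ltnNge rich.
  rewrite mulrA ler_pdivlMr ?ltr0n // -!natrM ler_nat => le1.
  (* With D = 3 E this is the source of the 9 in [S_card]. *)
  have le2 : (D.+2 * D.+1 <= 9 * (E.+1 * E.+1))%N by nia.
  rewrite -(ltn_pmul2r (isT : (0 < 2 * q.+1)%N)).
  have := leq_mul (leqnn #|S|) le2; have := leq_mul S_card (leqnn (E.+1 * E.+1)%N).
  move: le1; move: (D.+2 * D.+1)%N => X; nia.
have [c c0 Hc] := exists_common_root lt.
have tri i' j k : i' \in S -> j \in S -> k \in S ->
  e i' j -> e i' k -> e j k -> False by move=> _ _ _; apply: triangle_free.
case/eqP: c0; apply: box_poly_eq0.
apply: (no_vanishing_poly L_inj tri chK D_lt S0 slopes heights) => [i iS||].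
- by have := rich i iS; rewrite -ltnNge; apply: leq_trans; rewrite ltnS ltnW.
- exact: deg3_box_poly.
- exact: HP.
Qed.
End Lines.
End Vanishing.

End NullLines.

(** * The lines attached to triples of elements of A *)

Section Triples.
Variables (F : fieldType) (A : {fset F}).
Local Notation n := #|` A|.
Local Notation K := {fraction {poly F}}.
Local Notation trio := (A * A * A)%type.

(* The variable 'X is the shear parameter t. *)
Definition poly_line (w : trio + trio) : {poly F} * {poly F} * {poly F} :=
  match w with
  | inl (a, c, b') => ((val a)%:P, - (val c)%:P,
      (val b' * (val a - val c) - val a * val c)%:P + (val a)%:P * 'X)
  | inr (a', c', b) => ((val a')%:P, - (val c')%:P - 'X,
      (val b * (val a' - val c') - val a' * val c')%:P - (val a')%:P * 'X)
  end.

(* When a = c the line of (a, c, b') does not determine b'. *)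
Definition proper_trio (w : trio + trio) :=
  match w with inl x => x.1.1 != x.1.2 | inr x => x.1.1 != x.1.2 end.

Local Notation I := {w : trio + trio | proper_trio w}.

Definition grid_line (i : I) : K * K * K :=
  let l := poly_line (val i) in (tofrac l.1.1, tofrac l.1.2, tofrac l.2).

Lemma polyC_val_inj : injective (fun x : A => (val x)%:P : {poly F}).
Proof. by move=> x y E; apply: val_inj; apply: polyC_inj. Qed.

(** The coefficient of 'X in the second component tells the two kinds apart; within a kind, a and c
    can be read off, and the last entry is multiplied by a - c <> 0. *)
Lemma grid_line_inj : injective grid_line.
Proof.
move=> [u ui] [w wj] [] /eqP + /eqP + /eqP; rewrite !tofrac_eq => /eqP E1 /eqP E2 /eqP E3.
apply: val_inj; move: ui wj E1 E2 E3.
case: u w => [[[a c] b]|[[a c] b]] [[[a2 c2] b2]|[[a2 c2] b2]] /= ac ac2.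
- move=> /polyC_val_inj Ea; move: ac; rewrite Ea => ac /oppr_inj/polyC_val_inj Ec.
  rewrite Ec => /addIr/polyC_inj/addIr Eb; rewrite -Ea -Ec in ac2.
  congr (inl (_, _, _)); apply: val_inj; apply: (mulIf _ Eb).
  by rewrite subr_eq0 (inj_eq val_inj) -Ec.
- move=> _ /(congr1 (fun P : {poly F} => P`_1)).
  by rewrite !(coefB, coefN, coefC, coefX) /= oppr0 sub0r => /eqP; rewrite eq_sym oppr_eq0 oner_eq0.
- move=> _ /(congr1 (fun P : {poly F} => P`_1)).
  by rewrite !(coefB, coefN, coefC, coefX) /= oppr0 sub0r => /eqP; rewrite oppr_eq0 oner_eq0.
- move=> /polyC_val_inj Ea; move: ac; rewrite Ea => ac /addIr/oppr_inj/polyC_val_inj Ec.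
  rewrite Ec => /addIr/polyC_inj/addIr Eb; rewrite -Ea -Ec in ac2.
  congr (inr (_, _, _)); apply: val_inj; apply: (mulIf _ Eb).
  by rewrite subr_eq0 (inj_eq val_inj) -Ec.
Qed.

Lemma meets_grid_line i j : meets (grid_line i) (grid_line j) =
  let l := poly_line (val i) in let m := poly_line (val j) in
  (l.1.1 != m.1.1) && (l.2 - m.2 == (l.1.1 + m.1.1) * (l.1.2 - m.1.2)).
Proof. by rewrite /meets /= -!tofracB -tofracD -tofracM !tofrac_eq. Qed.

Definition left_side (w : trio + trio) := if w is inl _ then true else false.

(** For two lines of the same kind the coefficient of 'X in the meeting equation is, up to sign, the
    difference of their slopes, which [meets] requires to be nonzero. The meeting graph is therefore
    bipartite. *)
Lemma meets_sides i j : meets (grid_line i) (grid_line j) ->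
  left_side (val i) != left_side (val j).
Proof.
rewrite meets_grid_line; move: i j => [u /= _] [w /= _].
case: u w => [[[a c] b]|[[a c] b]] [[[a2 c2] b2]|[[a2 c2] b2]] //= /andP[+ /eqP].
  move=> nE /(congr1 (fun P : {poly F} => P`_1)); rewrite -?opprD -!polyCD !coefE /=.
  rewrite !mulr1 !add0r !oppr0 mulr0 => /subr0_eq Ea.
  by rewrite Ea eqxx in nE.
rewrite (_ : - (val c)%:P - 'X - _ = (val c2 - val c)%:P); last by rewrite polyCB; ring.
move=> nE /(congr1 (fun P : {poly F} => P`_1)); rewrite -polyCD -polyCM !coefE /=.
rewrite !mulr1 !sub0r opprK ; rewrite addrC => /subr0_eq Ea.
by rewrite Ea eqxx in nE.
Qed.

Lemma grid_line_triangle_free i j k : meets (grid_line i) (grid_line j) ->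
  meets (grid_line i) (grid_line k) -> meets (grid_line j) (grid_line k) -> False.
Proof.
move=> /meets_sides + /meets_sides + /meets_sides.
by case: (left_side (val i)); case: (left_side (val j)); case: (left_side (val k)).
Qed.

Lemma card_le_inj (T U : finType) (X : {set T}) (f : T -> U) :
  {in X &, injective f} -> (#|X| <= #|U|)%N.
Proof. by move/card_in_imset <-; apply: max_card. Qed.

Lemma grid_slopes (N : {set I}) : {in N &, injective (fun i => (grid_line i).1.1)} ->
  (#|N| <= 2 * n)%N.
Proof.
move=> inj; apply: (@leq_trans #|{: A}|); last by rewrite -!cardfE; lia.
pose f (i : I) : A := match val i with inl w => w.1.1 | inr w => w.1.1 end.
have fE i : (grid_line i).1.1 = tofrac (val (f i))%:P.
  by rewrite /f /=; case: i => [[[[a c] b]|[[a c] b]] gi].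
by apply: (@card_le_inj _ _ _ f) => i j iN jN E; apply: inj => //; rewrite !fE E.
Qed.

Lemma grid_heights (N : {set I}) : {in N &, injective (fun i => (grid_line i).1.2)} ->
  (#|N| <= 2 * n)%N.
Proof.
move=> inj; apply: (@leq_trans #|{: A + A}|); last by rewrite card_sum -!cardfE; lia.
pose f (i : I) : (A + A)%type := match val i with inl w => inl w.1.2 | inr w => inr w.1.2 end.
pose h (y : A + A) : {poly F} :=
  match y with inl c => - (val c)%:P | inr c => - (val c)%:P - 'X end.
have fE i : (grid_line i).1.2 = tofrac (h (f i)).
  by rewrite /f /h /=; case: i => [[[[a c] b]|[[a c] b]] gi].
by apply: (@card_le_inj _ _ _ f) => i j iN jN E; apply: inj => //; rewrite !fE E.
Qed.

Lemma card_proper_trio_le : (#|{: I}| <= 2 * n ^ 3)%N.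
Proof.
rewrite card_sig (leq_trans (max_card _)) // card_sum !card_prod -!cardfE.
rewrite !expnS; lia.
Qed.

Lemma pchar_fraction ch : ch \in [pchar F] -> ch \in [pchar K].
Proof.
move=> /(rmorph_pchar (polyC : {rmorphism F -> {poly F}})).
exact: (rmorph_pchar (@tofrac {poly F})).
Qed.

Variables (ch E q : nat).
Hypothesis chF : ch \in [pchar F].
Hypotheses (q_big : (15 * E + 2 * n < q)%N) (ch_big : (6 * E + 1 < ch)%N)
  (nEq : (9 * n ^ 3 <= E.+1 * q)%N).

Lemma card_meets_le :
  (#|[set x : I * I | meets (grid_line x.1) (grid_line x.2)]| <= 4 * q * n ^ 3)%N.
Proof.
have sym : ssrbool.symmetric (fun i j => meets (grid_line i) (grid_line j)).
  by move=> i j; apply: meetsC.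
have poor (S : {set I}) : S != set0 ->
    exists2 i, i \in S & (deg (fun i j => meets (grid_line i) (grid_line j)) S i <= q)%N.
  move=> S0.
  apply: (exists_poor_line (E := E) (ch := ch) (v := 2 * n)
    grid_line_inj grid_line_triangle_free) => //.
  - exact: pchar_fraction.
  - by rewrite -mul2n; lia.
  - exact: grid_slopes.
  - exact: grid_heights.
  - by rewrite mulnA.
  - have Sle := leq_trans (max_card S) card_proper_trio_le.
    by rewrite (leq_trans (leq_mul Sle (leqnn 9))) //; move: nEq; lia.
have := card_edges_le sym poor [set: I]; rewrite cardsT.
rewrite (_ : [set x | _] = [set x : I * I | meets (grid_line x.1) (grid_line x.2)]); last first.
  by apply/setP => x; rewrite !inE.
move=> /leq_trans; apply; apply: leq_trans (leq_mul (leqnn _) card_proper_trio_le) _.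
by rewrite mulnA (mulnAC 2).
Qed.

(** * From meeting pairs of lines to collinear triples *)

Local Notation six := (A * A * A * A * A * A)%type.

Definition six_det (w : six) : F :=
  let: (a, a', b, b', c, c') := w in
  val a * (val b' - val c') + val b * (val c' - val a') + val c * (val a' - val b').

Lemma card_six_det_le :
  (#|[set w : six | six_det w == 0%R]| <= 4 * n ^ 4 + 4 * q * n ^ 3)%N.
Proof.
pose quad := (A * A * A * A)%type.
have cq : #|{: quad}| = (n ^ 4)%N by rewrite !card_prod -!cardfE !expnS expn0; lia.
(* The degenerate cases: for a = c the determinant factors as (b - a) (c' - a'), for a' = c' as (a -
   c) (b' - a'), and for a = a', a <> c it is affine in b' with leading coefficient a - c. Each
   family is determined by four entries. *)
pose X1 := [set w : six | let: (a, a', b, b', c, c') := w in (a == c) && (b == a)].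
pose X2 := [set w : six | let: (a, a', b, b', c, c') := w in (a == c) && (a' == c')].
pose X3 := [set w : six | let: (a, a', b, b', c, c') := w in (a' == c') && (b' == a')].
pose X4 := [set w : six | let: (a, a', b, b', c, c') := w in
  [&& a == a', a != c & six_det w == 0%R]].
pose G := [set w : six | let: (a, a', b, b', c, c') := w in
  [&& a != a', a != c, a' != c' & six_det w == 0%R]].
have c1 : (#|X1| <= n ^ 4)%N.
  rewrite -cq; apply: (@card_le_inj _ _ _
    (fun w : six => let: (a, a', b, b', c, c') := w in (a, a', b', c'))).
  move=> [[[[[a a'] b] b'] c] c'] [[[[[x x'] y] y'] z] z']; rewrite !inE.
  by move=> /andP[/eqP<- /eqP->] /andP[/eqP<- /eqP->] [-> -> -> ->].
have c2 : (#|X2| <= n ^ 4)%N.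
  rewrite -cq; apply: (@card_le_inj _ _ _
    (fun w : six => let: (a, a', b, b', c, c') := w in (a, a', b, b'))).
  move=> [[[[[a a'] b] b'] c] c'] [[[[[x x'] y] y'] z] z']; rewrite !inE.
  by move=> /andP[/eqP<- /eqP<-] /andP[/eqP<- /eqP<-] [-> -> -> ->].
have c3 : (#|X3| <= n ^ 4)%N.
  rewrite -cq; apply: (@card_le_inj _ _ _
    (fun w : six => let: (a, a', b, b', c, c') := w in (a, a', b, c))).
  move=> [[[[[a a'] b] b'] c] c'] [[[[[x x'] y] y'] z] z']; rewrite !inE.
  by move=> /andP[/eqP<- /eqP->] /andP[/eqP<- /eqP->] [-> -> -> ->].
have c4 : (#|X4| <= n ^ 4)%N.
  rewrite -cq; apply: (@card_le_inj _ _ _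
    (fun w : six => let: (a, a', b, b', c, c') := w in (a, b, c, c'))).
  move=> [[[[[a a'] b] b'] c] c'] [[[[[x x'] y] y'] z] z']; rewrite !inE.
  move=> /and3P[/eqP<- ac /eqP E1] /and3P[/eqP<- _ /eqP E2] [Ea Eb Ec Ec']; subst x y z z'.
  have /eqP : (val a - val c) * (val b' - val y') = 0.
    by rewrite -[RHS](subrr 0) -{1}E1 -E2 /six_det; ring.
  by rewrite mulf_eq0 !subr_eq0 !(inj_eq val_inj) (negPf ac) => /eqP ->.
have c5 : (#|G| <= 4 * q * n ^ 3)%N.
  pose psi (x : I * I) : option six := match val x.1, val x.2 with
    | inl (a, c, b'), inr (a', c', b) => Some (a, a', b, b', c, c') | _, _ => None end.
  apply: leq_trans card_meets_le.
  rewrite -(card_imset G (@Some_inj _)); apply: leq_trans (leq_imset_card psi _).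
  apply: subset_leq_card; apply/subsetP => _ /imsetP[[[[[[a a'] b] b'] c] c'] + ->].
  rewrite inE => /and4P[aa' ac ac' /eqP E0]; apply/imsetP.
  exists (exist proper_trio (inl (a, c, b')) ac, exist proper_trio (inr (a', c', b)) ac') => //.
  rewrite inE meets_grid_line /= (inj_eq (@polyC_inj F)) (inj_eq val_inj) aa' /=.
  (* The terms (a + a') 'X on the two sides of the meeting equation cancel, and the rest is the
     determinant. *)
  apply/eqP/subr0_eq; rewrite -[RHS]/(0%:P) -E0 /six_det !(polyCB, polyCM, polyCD); ring.
have sub : [set w : six | six_det w == 0%R] \subset X1 :|: (X2 :|: (X3 :|: (X4 :|: G))).
  apply/subsetP => -[[[[[a a'] b] b'] c] c']; rewrite !inE => E0.
  have [Eac|ac] /= := eqVneq a c.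
    have := E0; rewrite /six_det -Eac.
    rewrite (_ : _ + _ = (val b - val a) * (val c' - val a')); last by ring.
    by rewrite mulf_eq0 !subr_eq0 !(inj_eq val_inj) [c' == a']eq_sym => /orP[] ->; rewrite ?orbT.
  have [Eac'|ac'] /= := eqVneq a' c'.
    have := E0; rewrite /six_det -Eac'.
    rewrite (_ : _ + _ = (val a - val c) * (val b' - val a')); last by ring.
    by rewrite mulf_eq0 !subr_eq0 !(inj_eq val_inj) (negPf ac) /= => ->.
  by rewrite E0; case: (a == a').
apply: leq_trans (subset_leq_card sub) _; rewrite !mulSn mul0n addn0 -!addnA.
by do 4![apply: leq_trans (leq_card_setU _ _) _; rewrite leq_add //].
Qed.

Lemma nb_collinear_triples_le :
  (nb_collinear_triples A <= 4 * n ^ 4 + 4 * q * n ^ 3)%N.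
Proof.
apply: leq_trans card_six_det_le.
pose f (w : six) : (F * F) * (F * F) * (F * F) :=
  let: (a, a', b, b', c, c') := w in ((val a, val a'), (val b, val b'), (val c, val c')).
rewrite /nb_collinear_triples cardE -(size_map f).
apply: uniq_leq_size; first exact: fset_uniq.
move=> [[[a a'] [b b']] [c c']]; rewrite inE /= => /andP[+ /asboolP/collinear_det].
rewrite !inE /= => /andP[/andP[/andP[aA aA'] /andP[bA bA']] /andP[cA cA']].
rewrite det_collinear_mx /= => E0; apply/mapP.
exists ([` aA], [` aA'], [` bA], [` bA'], [` cA], [` cA'])%fset => //.
by rewrite mem_enum inE /six_det /= -[X in _ == X]E0; apply/eqP; ring.
Qed.

End Triples.

(** * Choice of the parameters *)

Theorem proposition5 (R : realType) (C0 : R) (hC0 : 0 < C0) :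
  exists C : R, 0 < C /\
    forall (F : fieldType) (p : nat) (A : {fset F}),
      p \in [pchar F] -> odd p ->
      0 \notin A -> (1 < #|` A|)%N ->
      #|` A|%:R <= C0 * p%:R `^ (2 / 3) ->
      (nb_collinear_triples A)%:R <= C * #|` A|%:R `^ (9 / 2).
Proof.
(* Chosen so that |A|^(3/2) / k <= p / 12, which keeps the degrees below p. *)
pose k : R := 12 * C0 `^ (3 / 2) + 1.
have Cpos : 0 <= C0 `^ (3 / 2) by apply: powR_ge0.
have k1 : 1 <= k by rewrite /k; lra.
(* The 18 is 15 + 2 + 1: below, q <= 9 k s + 15 s + 2 n + 1, while n <= s and 1 <= s. *)
exists (4 + 4 * (9 * k + 18)); split; first by lra.
move=> F p A pF p_odd _; set n := #|` A| => n1 nle.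
have p3 : (2 < p)%N.
  by have := prime_gt1 (pcharf_prime pF); case: p p_odd {pF nle} => [|[|[|]]].
have n_ge1 : 1 <= n%:R :> R by rewrite ler1n ltnW.
have n_gt0 : 0 < n%:R :> R by lra.
set s := n%:R `^ (3 / 2) : R.
have s2 : s * s = n%:R ^+ 3.
  rewrite /s -powRD ?(gt_eqF n_gt0) ?implybT //.
  by rewrite (_ : 3 / 2 + 3 / 2 = 3%:R) ?powR_mulrn //; lra.
have ns : n%:R <= s.
  by rewrite -[leLHS]powRr1 ?ler_powR //; lra.
have sp : s <= C0 `^ (3 / 2) * p%:R.
  have -> : C0 `^ (3 / 2) * p%:R = (C0 * p%:R `^ (2 / 3)) `^ (3 / 2) :> R.
    rewrite powRM ?powR_ge0 ?(ltW hC0) // -powRrM (_ : 2 / 3 * (3 / 2) = 1) ?powRr1 //; by field.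
  by apply: ge0_ler_powR; rewrite ?nnegrE ?mulr_ge0 ?powR_ge0 ?(ltW hC0) //; lra.
have -> : n%:R `^ (9 / 2) = n%:R ^+ 3 * s.
  rewrite -powR_mulrn ?(ltW n_gt0) // -powRD ?(gt_eqF n_gt0) ?implybT //.
  by congr (_ `^ _); lra.
have k_gt0 : 0 < k by lra.
(* Here E + 1 > s / k and q > 9 k s give (E + 1) q >= 9 s^2 = 9 n^3, and the other terms of [y]
   dominate 15 E + 2 n. *)
pose E := Num.truncn (s / k); pose y := 9 * k * s + 15 * s + 2 * n%:R; pose q := (Num.truncn y).+1.
have sk : s / k <= s by rewrite ler_pdivrMr // ler_peMr //; lra.
have /andP[E_le E_gt] : E%:R <= s / k < E.+1%:R by apply: truncn_itv; rewrite divr_ge0 //; lra.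
have /andP[q_le q_gt] : (Num.truncn y)%:R <= y < q%:R.
  by apply: truncn_itv; rewrite /y; nra.
have qS : q%:R = (Num.truncn y)%:R + 1 :> R by rewrite natr1.
have nEq : (9 * n ^ 3 <= E.+1 * q)%N.
  rewrite -(ler_nat R) (natrM _ 9) natrX (natrM _ E.+1) -s2.
  have -> : 9 * (s * s) = (s / k) * (9 * k * s) by field; rewrite gt_eqF.
  by apply: ler_pM; rewrite ?divr_ge0 ?mulr_ge0 //; rewrite /y in q_gt; nra.
have qb : (15 * E + 2 * n < q)%N.
  rewrite -(ltr_nat R) natrD !natrM; apply: le_lt_trans q_gt; rewrite /y; nra.
(* As 6 E <= p / 2, it is enough that p > 2, which holds for odd p. *)
have pb : (6 * E + 1 < p)%N.
  rewrite -(ltr_nat R) natrD natrM.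
  have : s / k <= p%:R / 12 :> R.
    rewrite ler_pdivrMr // (le_trans sp) // /k; nra.
  have : 2 < p%:R :> R by rewrite ltr_nat.
  by lra.
have := nb_collinear_triples_le pF qb pb nEq; rewrite -(ler_nat R) => /le_trans; apply.
rewrite natrD (natrM _ 4) (natrM _ (4 * q)) (natrM _ 4) !natrX -/n.
have : n%:R ^+ 4 <= n%:R ^+ 3 * s by rewrite exprSr ler_wpM2l ?exprn_ge0 // ltW.
have : q%:R * n%:R ^+ 3 <= (9 * k + 18) * s * n%:R ^+ 3.
  apply: ler_wpM2r; first by rewrite exprn_ge0 // ltW.
  by rewrite qS; move: q_le; rewrite /y; nra.
by move: (n%:R ^+ 3) (n%:R ^+ 4) => N3 N4; nra.
Qed.
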